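(* For every integer $t>0$ and every positive integer $p$, $$D^*(t,p)\ \ge\ \frac{p\,[\,3t-2(p-1)\,]}{2}.$$
   Context: For a positive integer $n$ let $[n]=\{1,\dots,n\}$, and for a finite set $S$ of integers let $\Sigma(S)=\sum_{x\in S}x$. Balanced defining sets: for a positive integer $t$, $\mathcal S_t$ is the set of all ordered tuples $(S_1,\dots,S_{2t})$ of pairwise disjoint 2-element sets with $\bigcup_i S_i=[4t]$ such that $\Sigma(S_{2i-1})=\Sigma(S_{2i})$ for all $i\in[t]$. The sets $S_{2i-1},S_{2i}$ are called companion sets. Swaps: for a positive integer $p$, $\mathcal I_{t,p}$ is the family of all (possibly empty) finite sets of swaps $I=\{(i_1,j_1),\dots,(i_m,j_m)\}$, where $i_1,\dots,i_m,j_1,\dots,j_m\in[4t]$ are all distinct and $|i_\ell-j_\ell|\le p$ for all $\ell$ (a swap $(i,j)$ is regarded as unordered). Applying $I$ to $(S_1,\dots,S_{2t})$ means exchanging the labels $i_\ell$ and $j_\ell$ for every $\ell$; the resulting sets are denoted $S'_1,\dots,S'_{2t}$. Discrepancy: $D(S_1,\dots,S_{2t};I;t)=\sum_{i=1}^t|\Sigma(S'_{2i-1})-\Sigma(S'_{2i})|$, and $$D^*(t,p)=\min_{(S_1,\dots,S_{2t})\in\mathcal S_t}\ \max_{I\in\mathcal I_{t,p}} D(S_1,\dots,S_{2t};I;t).$$ *)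

(* Defs.v *)
From HB Require Import structures.
From mathcomp Require Import all_boot all_order all_algebra.
From mathcomp Require Import zify.

Set Implicit Arguments.
Unset Strict Implicit.
Unset Printing Implicit Defensive.

Local Open Scope nat_scope.

(* The ground set [4t] = {1, ..., 4t} is encoded by 'I_(4 * t): the ordinal x
   stands for the integer x.+1. *)
Definition label t (x : 'I_(4 * t)) : nat := x.+1.

Definition Sigma t (A : {set 'I_(4 * t)}) : nat := \sum_(x in A) label x.

(* Tuples are indexed from 0, so the companion sets S_{2i-1}, S_{2i} with
   1 <= i <= t are the entries 2i and 2i + 1 with i < t. *)
Definition fst_companion t (S : (2 * t).-tuple {set 'I_(4 * t)}) (i : 'I_t) :=
  nth set0 S (2 * i).

Definition snd_companion t (S : (2 * t).-tuple {set 'I_(4 * t)}) (i : 'I_t) :=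
  nth set0 S (2 * i).+1.

Definition balanced t : {set (2 * t).-tuple {set 'I_(4 * t)}} :=
  [set S : (2 * t).-tuple {set 'I_(4 * t)} |
    [&& [forall k, #|tnth S k| == 2],
        [forall k, forall l, (k != l) ==> [disjoint tnth S k & tnth S l]],
        \bigcup_k tnth S k == [set: 'I_(4 * t)]
      & [forall i : 'I_t,
           Sigma (fst_companion S i) == Sigma (snd_companion S i)]]].

(* A swap (i, j) is unordered, hence encoded as the two-element set {i, j};
   pairwise disjointness says that the endpoints of all swaps are distinct. *)
Definition swap_sets t p : {set {set {set 'I_(4 * t)}}} :=
  [set I : {set {set 'I_(4 * t)}} |
    [&& [forall e in I, #|e| == 2],
        trivIset I
      & [forall e in I, forall x in e, forall y in e,
           `|label x - label y|%N <= p]]].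

(* When I is in swap_sets t p, there is at most one y with {x, y} in I. *)
Definition swap_label t (I : {set {set 'I_(4 * t)}}) (x : 'I_(4 * t)) :=
  odflt x [pick y | [set x; y] \in I].

Definition apply_swaps t (I : {set {set 'I_(4 * t)}})
    (S : (2 * t).-tuple {set 'I_(4 * t)}) : (2 * t).-tuple {set 'I_(4 * t)} :=
  [tuple swap_label I @: tnth S k | k < 2 * t].

Definition discrepancy t (S : (2 * t).-tuple {set 'I_(4 * t)})
    (I : {set {set 'I_(4 * t)}}) : nat :=
  let S' := apply_swaps I S in
  \sum_(i < t) `|Sigma (fst_companion S' i) - Sigma (snd_companion S' i)|%N.

(* swap_sets t p always contains the empty set, and discrepancies are natural
   numbers, so the default value 0 of \max is harmless. *)
Definition max_discrepancy t p (S : (2 * t).-tuple {set 'I_(4 * t)}) : nat :=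
  \max_(I in swap_sets t p) discrepancy S I.

(* Balanced tuples exist: split [4t] into blocks of four consecutive integers
   a < b < c < d and take {a, d}, {b, c} as companions. *)
Definition block_set t (k : nat) : {set 'I_(4 * t)} :=
  [set x : 'I_(4 * t) | (x %/ 4 == k %/ 2) &&
     (((x %% 4 == 1) || (x %% 4 == 2)) == (k %% 2 == 1))].

Lemma block_setP t k : k < 2 * t ->
  exists a b : 'I_(4 * t), [/\ block_set t k = [set a; b], a < b
    & a + b = 8 * (k %/ 2) + 3].
Proof.
move=> lt_k; have [k1|k0] := boolP (k %% 2 == 1).
- have la : 4 * (k %/ 2) + 1 < 4 * t by lia.
  have lb : 4 * (k %/ 2) + 2 < 4 * t by lia.
  exists (Ordinal la), (Ordinal lb); split => /=; [|lia|lia].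
  apply/setP=> x; rewrite !inE k1 -!val_eqE /=; lia.
- have la : 4 * (k %/ 2) < 4 * t by lia.
  have lb : 4 * (k %/ 2) + 3 < 4 * t by lia.
  exists (Ordinal la), (Ordinal lb); split => /=; [|lia|lia].
  apply/setP=> x; rewrite !inE (negbTE k0) -!val_eqE /=; lia.
Qed.

Lemma Sigma_block_set t k : k < 2 * t ->
  Sigma (block_set t k) = 8 * (k %/ 2) + 5.
Proof.
move=> /block_setP [a [b [-> lt_ab sum_ab]]].
rewrite /Sigma big_setU1 /= ?big_set1 /label; first by lia.
by rewrite inE -val_eqE /=; lia.
Qed.

Lemma balanced_exists t : exists S, S \in balanced t.
Proof.
exists [tuple block_set t k | k < 2 * t]; rewrite inE.
apply/and4P; split.
- apply/forallP=> k; rewrite tnth_mktuple.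
  have [a [b [-> lt_ab _]]] := block_setP (ltn_ord k).
  rewrite cards2 -val_eqE /=; lia.
- apply/forallP=> k; apply/forallP=> l; apply/implyP=> ne_kl.
  rewrite !tnth_mktuple -setI_eq0; apply/eqP/setP=> x.
  move: ne_kl; rewrite !inE -val_eqE /=; lia.
- apply/eqP/setP=> x; rewrite in_setT; apply/bigcupP.
  pose j := 2 * (x %/ 4) + ((x %% 4 == 1) || (x %% 4 == 2)).
  have lt_j : j < 2 * t by rewrite /j; have := ltn_ord x; lia.
  exists (Ordinal lt_j) => //; rewrite tnth_mktuple inE /= /j; lia.
- apply/forallP=> i; rewrite /fst_companion /snd_companion.
  have l0 : 2 * i < 2 * t by have := ltn_ord i; lia.
  have l1 : (2 * i).+1 < 2 * t by have := ltn_ord i; lia.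
  rewrite -(tnth_nth set0 _ (Ordinal l0)) -(tnth_nth set0 _ (Ordinal l1)).
  rewrite !tnth_mktuple !Sigma_block_set //=; apply/eqP; lia.
Qed.

Lemma max_discrepancy_exists t p :
  exists d, [exists S in balanced t, max_discrepancy p S == d].
Proof.
have [S inS] := balanced_exists t; exists (max_discrepancy p S).
by apply/existsP; exists S; rewrite inS eqxx.
Qed.

Definition Dstar t p : nat := ex_minn (max_discrepancy_exists t p).

(* Main.v *)
(* A companion pair is a quadruple a < b < c < d with a + d = b + c, one set
   being {a, d} and the other {b, c}.  Give {a, d} one sign and {b, c} the other,
   freely for each pair; swapping every x of sign + with x + p of sign - (these
   swaps are automatically disjoint) gains 2p each, so it suffices to find signs
   with many such descents.  For random signs the expected value of the sum of
   f(x) f(x + p) is at most t, because each pair contributes at most one x with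
   x and x + p in the same set; this gives 4 * #descents >= 3t - p, which is
   enough for p >= 2.

   For p = 1 one closes [4t] into a cycle.  The expectation argument loses 1 only
   when all pairs have c = b + 1 < d - 1 and {1, 4t} is one of the sets, and even
   then some choice of signs beats the average unless, for any two pairs, the
   signed number of adjacencies between them vanishes.  Such a flat configuration
   does not exist: apart from local exceptions, vanishing forces each pair to
   contain, in each half of [a, d], a pair of about half its length, so the pairs
   form a binary tree below {1, 4t}, whose leaves have d - a = 5 or 7; leaves of
   both kinds must occur, and going up the tree d - a + 5 doubles, so that
   d - a + 5 at the root would be both 10 * 2^e and 12 * 2^f. *)
Require Import Defs.
From mathcomp Require Import all_boot all_order all_algebra.
From mathcomp Require Import zify ring lra.

Import Order.TTheory GRing.Theory Num.Theory.

Set Implicit Arguments.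
Unset Strict Implicit.
Unset Printing Implicit Defensive.

(** * Flat configurations do not exist *)

Section FlatConfiguration.

Variables (I : finType) (N : nat) (a b d : I -> nat) (r : I).

Definition token i x := [|| x == a i, x == d i, x == b i | x == (b i).+1].

Definition weight k x : int :=
  ((x == a k) + (x == d k))%:Z - ((x == b k) + (x == (b k).+1))%:Z.

Hypothesis a_gt0 : forall i, 0 < a i.
Hypothesis ab : forall i, a i + 2 <= b i.
Hypothesis sum_ad : forall i, a i + d i = b i + (b i).+1.
Hypothesis d_le : forall i, d i <= N.
Hypothesis token_cover : forall x, 0 < x <= N -> exists i, token i x.
Hypothesis token_inj : forall i j x, token i x -> token j x -> i = j.
Hypothesis root_a : a r = 1.
Hypothesis root_d : d r = N.
(* The signed number of adjacencies between i and another pair k is zero; the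
   inner elements of i are the adjacent b i and (b i).+1. *)
Hypothesis flat : forall i k, i != k ->
  (weight k (a i).-1 + weight k (a i).+1 + weight k (d i).-1 + weight k (d i).+1
   = weight k (b i).-1 + weight k (b i).+2)%R.

Variant weight_spec k x : int -> Prop :=
| WeightA of x = a k : weight_spec k x 1
| WeightD of x = d k : weight_spec k x 1
| WeightB of x = b k : weight_spec k x (-1)
| WeightC of x = (b k).+1 : weight_spec k x (-1)
| Weight0 of ~~ token k x : weight_spec k x 0.

Lemma weightP k x : weight_spec k x (weight k x).
Proof.
have := ab k; have := sum_ad k => hs hb.
have [h|h] := boolP (token k x); last first.
  have -> : weight k x = 0 by rewrite /weight; move: h; rewrite /token; lia.
  by constructor.
by case/or4P: (h) => /eqP e; [have ->: weight k x = 1 by rewrite /weight; lia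
 | have ->: weight k x = 1 by rewrite /weight; lia
 | have ->: weight k x = (-1)%R by rewrite /weight; lia
 | have ->: weight k x = (-1)%R by rewrite /weight; lia];
 [exact: WeightA | exact: WeightD | exact: WeightB | exact: WeightC].
Qed.

Lemma token_a i : token i (a i). Proof. by rewrite /token eqxx. Qed.
Lemma token_d i : token i (d i). Proof. by rewrite /token eqxx orbT. Qed.
Lemma token_b i : token i (b i). Proof. by rewrite /token eqxx !orbT. Qed.
Lemma token_c i : token i (b i).+1. Proof. by rewrite /token eqxx !orbT. Qed.

(* Since d i - a i = 2 * height i + 1, heights 2 and 3 stand for d - a = 5 and 7. *)
Definition height i := b i - a i.

(* [j] spans one half of [i]: an outer element of [j] touches an outer element of
   [i], and the other one touches the inner elements of [i].  Of the four
   combinations, [inner_half] keeps those where [j] lies inside that half. *)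
Definition left_half j i :=
  ((a j == (a i).+1) || ((a j).+1 == a i)) && (((d j).+1 == b i) || (d j == (b i).+2)).
Definition right_half j i :=
  (((d j).+1 == d i) || (d j == (d i).+1)) && ((a j == (b i).+2) || ((a j).+1 == b i)).
Definition is_half j i := left_half j i || right_half j i.
Definition inner_half j i :=
  (a j == (a i).+1) && ((d j).+1 == b i) || (a j == (b i).+2) && ((d j).+1 == d i).

(* The inner elements of [i] are stuck between the inner and the outer elements
   of a pair with d - a = 7. *)
Definition dead i := exists2 j, height j = 3 & b j = (b i).+2 \/ b i = (b j).+2.

Lemma token_neq i j x : i != j -> token i x -> token j x = false.
Proof. by move=> ne ti; apply/negP => tj; case/eqP: ne; apply: token_inj ti tj. Qed.

Lemma weight_bounds k x : (-1 <= weight k x <= 1)%R.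
Proof. by case: weightP. Qed.

Lemma weight_gt0 k x : (0 < weight k x)%R -> (x == a k) || (x == d k).
Proof. by case: weightP => // ->; rewrite eqxx ?orbT. Qed.

Lemma weight_lt0 k x : (weight k x < 0)%R -> (x == b k) || (x == (b k).+1).
Proof. by case: weightP => // ->; rewrite eqxx ?orbT. Qed.

Lemma weight_outer k x : (x == a k) || (x == d k) -> weight k x = 1.
Proof. have := ab k; have := sum_ad k; rewrite /weight; lia. Qed.

Lemma weight_inner k x : (x == b k) || (x == (b k).+1) -> weight k x = (-1)%R.
Proof. have := ab k; have := sum_ad k; rewrite /weight; lia. Qed.

Lemma disjoint_tokens i j : i != j ->
  [/\ [/\ a i <> a j, a i <> d j, a i <> b j & a i <> (b j).+1],
      [/\ d i <> a j, d i <> d j, d i <> b j & d i <> (b j).+1],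
      [/\ b i <> a j, b i <> d j & b i <> b j]
    & [/\ (b i).+1 <> a j, (b i).+1 <> d j, (b i).+1 <> b j & b i <> (b j).+1]].
Proof.
move=> ne; have neP := token_neq ne.
move: (neP _ (token_a i)) (neP _ (token_d i)) (neP _ (token_b i)) (neP _ (token_c i)).
rewrite /token; do 4! case/norP=> /eqP ? /norP[/eqP ? /norP[/eqP ? /eqP ?]].
by move: (neP (b i) (token_b i)); rewrite /token; do 3!case/norP=> /eqP ?.
Qed.

(** * Local structure around the inner elements of a pair *)

Lemma dead_intro i j : height j = 3 -> (b j == (b i).+2) || (b i == (b j).+2) -> dead i.
Proof. by move=> hj /orP bij; exists j => //; case: bij => /eqP; [left | right]. Qed.

Ltac end_cases i j :=
  first [exfalso; lia | constructor 1; rewrite /height; lia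
     | constructor 2; apply: (@dead_intro i j); rewrite /height; lia
     | constructor 3; split; [rewrite /height; lia | exists j; lia]
     | constructor 4; exists j; lia].

(* The neighbour of [b i] must belong to a pair having another adjacency with [i],
   of the opposite sign. *)
Lemma left_end i : [\/ height i = 2, dead i,
    height i = 3 /\ (exists j, (b j).+2 = b i)
  | exists j, ((a j == (a i).+1) || ((a j).+1 == a i)) && ((d j).+1 == b i)
              || (((d j).+1 == d i) || (d j == (d i).+1)) && ((a j).+1 == b i)].
Proof.
have := ab i; have := sum_ad i; have := d_le i; have := a_gt0 i => hi0 hi1 hi2 hi3.
have [|j tj] := @token_cover (b i).-1; first by lia.
have [e|ne] := eqVneq i j.
  by move: tj; rewrite -e /token => h; constructor 1; rewrite /height; lia.
have := ab j; have := sum_ad j; have := d_le j; have := a_gt0 j => hj0 hj1 hj2 hj3.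
have := flat ne.
have := weight_bounds j (a i).-1; have := weight_bounds j (a i).+1.
have := weight_bounds j (d i).-1; have := weight_bounds j (d i).+1.
have := weight_bounds j (b i).+2.
have [[? ? ? ?] [? ? ? ?] [? ? ?] [? ? ? ?]] := disjoint_tokens ne.
case: (weightP j (b i).-1) tj => [e|e|e|e|/negbTE ->] // _ w1 w2 w3 w4 w5 w.
1,2: have {w w1 w2 w3 w4 w5} /or4P [/weight_gt0|/weight_gt0|/weight_gt0|/orP [/weight_gt0|/weight_lt0]]:
    [|| (0 < weight j (a i).-1)%R, (0 < weight j (a i).+1)%R, (0 < weight j (d i).-1)%R,
     (0 < weight j (d i).+1)%R | (weight j (b i).+2 < 0)%R]; first by lia.
1-10: case/orP => /eqP e'.
1-20: by end_cases i j.
have {w w1 w2 w3 w4 w5} /or4P [/weight_lt0|/weight_lt0|/weight_lt0|/orP [/weight_lt0|/weight_gt0]]: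
    [|| (weight j (a i).-1 < 0)%R, (weight j (a i).+1 < 0)%R, (weight j (d i).-1 < 0)%R,
     (weight j (d i).+1 < 0)%R | (0 < weight j (b i).+2)%R]; first by lia.
1-5: by case/orP => /eqP e'; end_cases i j.
have {w w1 w2 w3 w4 w5} /or4P [/weight_lt0|/weight_lt0|/weight_lt0|/orP [/weight_lt0|/weight_gt0]]:
    [|| (weight j (a i).-1 < 0)%R, (weight j (a i).+1 < 0)%R, (weight j (d i).-1 < 0)%R,
     (weight j (d i).+1 < 0)%R | (0 < weight j (b i).+2)%R]; first by lia.
1-5: by case/orP => /eqP e'; end_cases i j.
Qed.

Lemma right_end i : [\/ height i = 2, dead i,
    height i = 3 /\ (exists j, b j = (b i).+2)
  | exists j, (((d j).+1 == d i) || (d j == (d i).+1)) && (a j == (b i).+2)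
              || ((a j == (a i).+1) || ((a j).+1 == a i)) && (d j == (b i).+2)].
Proof.
have := ab i; have := sum_ad i; have := d_le i; have := a_gt0 i => hi0 hi1 hi2 hi3.
have [|j tj] := @token_cover (b i).+2; first by lia.
have [e|ne] := eqVneq i j.
  by move: tj; rewrite -e /token => h; constructor 1; rewrite /height; lia.
have := ab j; have := sum_ad j; have := d_le j; have := a_gt0 j => hj0 hj1 hj2 hj3.
have := flat ne.
have := weight_bounds j (a i).-1; have := weight_bounds j (a i).+1.
have := weight_bounds j (d i).-1; have := weight_bounds j (d i).+1.
have := weight_bounds j (b i).-1.
have [[? ? ? ?] [? ? ? ?] [? ? ?] [? ? ? ?]] := disjoint_tokens ne.
case: (weightP j (b i).+2) tj => [e|e|e|e|/negbTE ->] // _ w1 w2 w3 w4 w5 w.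
1,2: have {w w1 w2 w3 w4 w5} /or4P [/weight_gt0|/weight_gt0|/weight_gt0|/orP [/weight_gt0|/weight_lt0]]:
    [|| (0 < weight j (a i).-1)%R, (0 < weight j (a i).+1)%R, (0 < weight j (d i).-1)%R,
     (0 < weight j (d i).+1)%R | (weight j (b i).-1 < 0)%R]; first by lia.
1-10: case/orP => /eqP e'.
1-20: by end_cases i j.
have {w w1 w2 w3 w4 w5} /or4P [/weight_lt0|/weight_lt0|/weight_lt0|/orP [/weight_lt0|/weight_gt0]]:
    [|| (weight j (a i).-1 < 0)%R, (weight j (a i).+1 < 0)%R, (weight j (d i).-1 < 0)%R,
     (weight j (d i).+1 < 0)%R | (0 < weight j (b i).-1)%R]; first by lia.
1-5: by case/orP => /eqP e'; end_cases i j.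
have {w w1 w2 w3 w4 w5} /or4P [/weight_lt0|/weight_lt0|/weight_lt0|/orP [/weight_lt0|/weight_gt0]]:
    [|| (weight j (a i).-1 < 0)%R, (weight j (a i).+1 < 0)%R, (weight j (d i).-1 < 0)%R,
     (weight j (d i).+1 < 0)%R | (0 < weight j (b i).-1)%R]; first by lia.
1-5: by case/orP => /eqP e'; end_cases i j.
Qed.

Lemma weight_none k x : ~~ token k x -> weight k x = 0.
Proof. by case: weightP => // ->; rewrite (token_a, token_d, token_b, token_c). Qed.

(** The neighbours of the inner elements of [i] would be an outer and an inner element of [j], which
    cancel. Among the neighbours of the outer elements only [(d i).-1] lies in [j], so [flat] would
    read -1 = 0. *)
Lemma no_adjacent_sevens i j : height i = 3 -> height j = 3 -> b j = (b i).+2 -> False.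
Proof.
rewrite /height => hi hj e.
have := ab i; have := sum_ad i; have := ab j; have := sum_ad j => *.
have ne : i != j by apply/eqP=> eij; move: e; rewrite eij; lia.
have := flat ne.
rewrite (@weight_outer j (b i).-1) ?(@weight_inner j (b i).+2) ?(@weight_inner j (d i).-1);
  try (apply/orP; lia).
by rewrite !weight_none //; rewrite /token; lia.
Qed.

(** With height 2, an outer element of [i] would coincide with an inner element of the witness [j];
    height 3 is excluded by [no_adjacent_sevens]. *)
Lemma dead_height i : dead i -> 3 < height i.
Proof.
case=> j hj bij; have ne : i != j by apply/eqP=> e; move: bij; rewrite e; lia.
have [e|n3] := eqVneq (height i) 3.
  by case: bij => /(no_adjacent_sevens _ _) H; [case: (H e hj) | case: (H hj e)].
have := ab i; have := sum_ad i; have := ab j; have := sum_ad j.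
have [[? ? ? ?] [? ? ? ?] [? ? ?] [? ? ? ?]] := disjoint_tokens ne.
move: hj n3; rewrite /height; lia.
Qed.

Lemma half_height i j : is_half j i ->
  [\/ height i = 2 * height j + 3, height i = 2 * height j + 1,
      height i = 2 * height j | height i + 2 = 2 * height j].
Proof.
have := ab i; have := sum_ad i; have := ab j; have := sum_ad j.
rewrite /is_half /left_half /right_half /height => *.
have : height i = 2 * height j + 3 \/ height i = 2 * height j + 1 \/
      height i = 2 * height j \/ height i + 2 = 2 * height j by rewrite /height; lia.
by case=> [?|[?|[?|?]]]; [constructor 1|constructor 2|constructor 3|constructor 4].
Qed.

(** This is the doubling law: [height i + 3] is twice [height j + 3]. *)
Lemma inner_half_height i j : inner_half j i -> height i = 2 * height j + 3.
Proof.
have := ab i; have := sum_ad i; have := ab j; have := sum_ad j.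
rewrite /inner_half /height; lia.
Qed.

Lemma classify i : [\/ height i = 2, dead i,
    height i = 3 /\ (exists j m, (b j).+2 = b i /\ b m = (b i).+2)
  | 3 < height i /\ exists j m,
    [&& (a j == (a i).+1) || ((a j).+1 == a i), ((d m).+1 == d i) || (d m == (d i).+1)
      & ((d j).+1 == b i) && (a m == (b i).+2) || (d j == (b i).+2) && ((a m).+1 == b i)]].
Proof.
have hi := ab i; have si := sum_ad i.
have [|n2] := eqVneq (height i) 2; first by constructor 1.
case: (left_end i) => [|||[j hj]]; [by constructor 1|by constructor 2| |].
- case=> h3 [j ej]; case: (right_end i) => [||[_ [m em]]|[m hm]]; [by constructor 1|by constructor 2| |].
    by constructor 3; split => //; exists j, m.
  exfalso; move: h3 hm; rewrite /height; have := ab m; have := sum_ad m; lia.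
have := ab j; have := sum_ad j => sj aj.
case: (right_end i) => [||[h3 [m em]]|[m hm]]; [by constructor 1|by constructor 2| |].
  exfalso; move: h3 hj; rewrite /height; lia.
have := ab m; have := sum_ad m => sm am; constructor 4.
split; first by move: n2 hj; rewrite /height; lia.
(* Every [a + d] is odd, so by parity [j] and [m] cannot sit at the same end of [i]. If [j] reaches
   across the inner elements then so does [m], and their roles are exchanged. *)
have [e|ne] := boolP ((d j).+1 == b i); [exists j, m | exists m, j]; lia.
Qed.

(** * Pairs whose inside adjacencies cancel *)

Variant weight_before_spec k x : int -> Prop :=
| BeforeA of x = a k : weight_before_spec k x 1
| BeforeD of x = d k : weight_before_spec k x 1
| BeforeC of x = (b k).+1 : weight_before_spec k x (-1)
| Before0 of ~~ token k x : weight_before_spec k x 0.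

(** The case [x = b k] drops out: [x.+1] would be the other inner element of [k], yet it belongs to
    [i]. *)
Lemma weight_beforeP i k x : k != i -> token i x.+1 -> weight_before_spec k x (weight k x).
Proof.
move=> nk tx; case: weightP => e; try by constructor.
by case/eqP: nk; apply: token_inj tx; rewrite e token_c.
Qed.

Variant weight_after_spec k x : int -> Prop :=
| AfterA of x = a k : weight_after_spec k x 1
| AfterD of x = d k : weight_after_spec k x 1
| AfterB of x = b k : weight_after_spec k x (-1)
| After0 of ~~ token k x : weight_after_spec k x 0.

Lemma weight_afterP i k x : k != i -> token i x -> weight_after_spec k x.+1 (weight k x.+1).
Proof.
move=> nk tx; case: weightP => e; try by constructor.
by case/eqP: nk; apply: token_inj tx; case: e => ->; rewrite token_b.
Qed.

(* All adjacencies of [i] cancel except those at the two ends of [a i, d i]. *)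
Definition sealed i := forall k, k != i -> (weight k (a i).-1 + weight k (d i).+1 = 0)%R.

(** The two end weights are both zero or opposite. If opposite, one end of [i] touches an outer
    element of [k] and the other an inner one, and the order of the elements leaves only a half of
    [k] filled by [i] from inside. *)
Lemma sealed_cases i k : sealed i -> k != i ->
  inner_half i k \/ ~~ token k (a i).-1 /\ ~~ token k (d i).+1.
Proof.
move=> ci nk; have := ab i; have := sum_ad i; have := a_gt0 i; have := ab k; have := sum_ad k => *.
have ta : token i (a i).-1.+1 by rewrite prednK // token_a.
move: (ci k nk); case: (weight_beforeP nk ta) => e; case: (weight_afterP nk (token_d i)) => e' w //;
  first [by left; rewrite /inner_half; lia | by right].
Qed.

Lemma sealed_half i k : sealed i -> is_half i k ->
  [\/ inner_half i k, a k = (a i).+1 /\ d i = (b k).+2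
    | (d k).+1 = d i /\ b k = (a i).+1].
Proof.
move=> ci hk.
have nk : k != i by apply/eqP=> e; move: hk; rewrite e /is_half /left_half /right_half; lia.
have [|[na nd]] := sealed_cases ci nk; first by constructor 1.
have {}na x : x.+1 = a i -> ~~ token k x by move=> e; rewrite -[x]/(x.+1.-1) e.
have {}nd x : x = (d i).+1 -> ~~ token k x by move->.
case/orP: hk => /andP[/orP[]/eqP e1 /orP[]/eqP e2].
- by have := na (a k); rewrite token_a => /(_ (esym e1)).
- by have := na (a k); rewrite token_a => /(_ (esym e1)).
- by have := nd (b k); rewrite token_b => /(_ (esym e2)).
- by constructor 2; split; rewrite // -e1.
- by have := nd (d k); rewrite token_d => /(_ (esym e1)).
- by have := nd (d k); rewrite token_d => /(_ (esym e1)).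
- by have := na (b k).+1; rewrite token_c => /(_ (esym e2)).
- by constructor 3; split; rewrite // -e1.
Qed.

(** As 1 belongs to [r], some pair covers [(a i).-1], and [sealed_cases] makes [i] an inner half of
    it. *)
Lemma sealed_parent i : sealed i -> i != r -> exists k, inner_half i k.
Proof.
move=> ci ne; have := ab i; have := sum_ad i; have := d_le i; have := a_gt0 i => *.
have a1 : a i <> 1 by rewrite -root_a => e; case/eqP: ne; apply: token_inj (token_a i) _; rewrite e token_a.
have [|k tk] := @token_cover (a i).-1; first by lia.
have nk : k != i by apply: contraTneq tk => ->; rewrite /token; lia.
by have [|[]] := sealed_cases ci nk; [exists k | rewrite tk].
Qed.

Lemma half_touches j k x : is_half j k -> (x == a j) || (x == d j) ->
  token k x.-1 || token k x.+1.
Proof.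
move=> hjk; have ja := a_gt0 j.
have step y : token k y -> x.+1 = y \/ x = y.+1 -> token k x.-1 || token k x.+1.
  by move=> ty [-> | ->]; rewrite ty ?orbT.
move=> /orP[]/eqP ex; subst x;
  case/orP: hjk => /andP[/orP[]/eqP e1 /orP[]/eqP e2].
all: first [by apply: (step (a k)); [exact: token_a | lia]
  | by apply: (step (d k)); [exact: token_d | lia]
  | by apply: (step (b k)); [exact: token_b | lia]
  | by apply: (step (b k).+1); [exact: token_c | lia]].
Qed.

Lemma outer_not_inner k l x :
  (x == a k) || (x == d k) -> (x == b l) || (x == (b l).+1) -> False.
Proof.
move=> xk xl.
have e : k = l by apply: (@token_inj _ _ x); rewrite /token orbA ?xk // -orbA xl !orbT.
by move: xk xl; rewrite e; have := ab l; have := sum_ad l; lia.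
Qed.

Lemma weight_bc k l : weight k (b l) = weight k (b l).+1.
Proof.
have [->|ne] := eqVneq k l; first by rewrite !weight_inner ?eqxx ?orbT.
by rewrite !weight_none // (@token_neq l) // 1?eq_sym // (token_b, token_c).
Qed.

Lemma weight_ad k l : weight k (a l) = weight k (d l).
Proof.
have [->|ne] := eqVneq k l; first by rewrite !weight_outer ?eqxx ?orbT.
by rewrite !weight_none // (@token_neq l) // 1?eq_sym // (token_a, token_d).
Qed.

(** * Nested pairs and the exclusion of attached dead pairs *)

Definition attached i := exists k, is_half i k.

Definition clear_of_attached i := forall j, dead j -> attached j ->
  ~~ (a i <= a j <= d i) && ~~ (a i <= d j <= d i).

Definition nested i :=
  [/\ sealed i, (forall k, is_half i k -> inner_half i k) & clear_of_attached i].

(** In each shape given by [classify], the neighbour of an outer element on the inside is matched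
    with a neighbour of an inner element: the same element, or its partner of equal weight in
    another pair. These terms of [flat] cancel, leaving those at the two ends. *)
Lemma nested_step i : ~ dead i ->
  (forall j, is_half j i -> height j < height i -> nested j) -> nested i.
Proof.
move=> ndi IH; have hi0 := a_gt0 i; have hi1 := ab i; have hi2 := sum_ad i; have hi3 := d_le i.
case: (classify i) => [h2|//|[h3 [j [m [ej em]]]]|[h3 [j [m /and3P [aj dm bjm]]]]].
- have ea : (a i).+1 = (b i).-1 by move: h2; rewrite /height; lia.
  have ed : (d i).-1 = (b i).+2 by lia.
  have ci : sealed i.
    by move=> k nk; have := flat (i:=i) (k:=k); rewrite eq_sym nk => /(_ isT); rewrite ea ed; lia.
  split=> //.
  + move=> k hk.
    have nk : k != i by apply/eqP=> e; move: hk; rewrite e /is_half /left_half /right_half; lia.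
    have nb := token_neq nk (token_b k); have nc := token_neq nk (token_c k).
    case: (sealed_half ci hk) => // -[e1 e2]; [move: nb | move: nc]; rewrite /token; lia.
  + move=> j' dj [k hk].
    have hdj := dead_height dj.
    have nj : j' != i by apply/eqP=> e; apply: ndi; rewrite -e.
    have nki : k != i.
      by apply/eqP=> e; have := half_height hk; rewrite e; case; lia.
    (* Both neighbours of an element in a one-element gap belong to [i], so the pair having [j'] as
       a half would be [i] itself. *)
    have out x : (x == a j') || (x == d j') -> ~~ (a i <= x <= d i).
      move=> xj; apply/negP => xi.
      have tx : token j' x by rewrite /token orbA xj.
      have ntx : token i x = false by apply/negP => /(token_inj tx) e; case/eqP: nj.
      have [t1 t2] : token i x.-1 /\ token i x.+1.
        by split; move: h2 ntx xi; rewrite /height /token; lia.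
      by case/orP: (half_touches hk xj) => t; case/eqP: nki; apply: token_inj t _.
    by rewrite !out ?eqxx ?orbT.
- have h33 := no_adjacent_sevens.
  have nij : j != i by apply/eqP=> e; move: ej; rewrite e; lia.
  have nim : m != i by apply/eqP=> e; move: em; rewrite e; lia.
  have ea : (a i).+1 = b j by move: h3; rewrite /height; lia.
  have ed : (d i).-1 = (b m).+1 by move: h3; rewrite /height; lia.
  have ci : sealed i.
    move=> k nk; have := flat (i:=i) (k:=k); rewrite eq_sym nk => /(_ isT).
    rewrite ea ed -weight_bc -em -ej -weight_bc; lia.
  split=> //.
  + move=> k hk.
    have [hj hm] := (ab j, ab m); have [sj sm] := (sum_ad j, sum_ad m).
    case: (sealed_half ci hk) => // -[e1 e2]; exfalso.
    * have ek : k = j by apply: token_inj (token_a k) _; rewrite e1 ea token_b.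
      move: e2; rewrite ek; lia.
    * have ek : k = j by apply: token_inj (token_b k) _; rewrite e2 ea token_b.
      apply: (@outer_not_inner k m (d k)); rewrite ?eqxx ?orbT //.
      by apply/orP; right; apply/eqP; lia.
  + move=> j' dj [k hk].
    have nj : j' != i by apply/eqP=> e; apply: ndi; rewrite -e.
    have out x : (x == a j') || (x == d j') -> ~~ (a i <= x <= d i).
      move=> xj; apply/negP => xi.
      have nxi : ~~ ((x == a i) || (x == d i)).
        apply/negP => e; case/eqP: nj; apply: (@token_inj _ _ x); by rewrite /token orbA ?xj ?e.
      have oni := @outer_not_inner _ i _ xj; have onj := @outer_not_inner _ j _ xj.
      have onm := @outer_not_inner _ m _ xj.
      (* The span of a pair of height 3 has eight elements: its own four and the inner elements of
         [j] and [m]. *)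
      have [/oni//|[/onj//|/onm//]] : (x == b i) || (x == (b i).+1) \/
        ((x == b j) || (x == (b j).+1) \/ (x == b m) || (x == (b m).+1)).
      move: nxi xi ea ed h3 ej em hi2; rewrite /height; clear; lia.
    by rewrite !out ?eqxx ?orbT.
- have hj : is_half j i by move: aj bjm; rewrite /is_half /left_half; clear; lia.
  have hm : is_half m i by move: dm bjm; rewrite /is_half /right_half; clear; lia.
  have [_ ij cj] : nested j by apply: IH => //; have := half_height hj; case; lia.
  have [_ im cm] : nested m by apply: IH => //; have := half_height hm; case; lia.
  have [sj sm] := (sum_ad j, sum_ad m); have [abj abm] := (ab j, ab m).
  have {aj}[aj dj] : a j = (a i).+1 /\ (d j).+1 = b i.
    by move: (ij _ hj) aj; rewrite /inner_half; clear -sj abj hi1 hi2; lia.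
  have {dm bjm}[am dm] : a m = (b i).+2 /\ (d m).+1 = d i.
    by move: (im _ hm) dm; rewrite /inner_half; clear -sm abm hi1 hi2; lia.
  have ci : sealed i.
    move=> k nk; have := flat (i:=i) (k:=k); rewrite eq_sym nk => /(_ isT).
    by rewrite -aj -am -dj -dm /= weight_ad (weight_ad _ m); lia.
  split=> //.
  + move=> k hk; case: (sealed_half ci hk) => // -[e1 e2]; exfalso.
    * have ek : k = j by apply: token_inj (token_a k) _; rewrite e1 -aj token_a.
      by move: e2; rewrite ek; lia.
    * have ek : k = m by apply: token_inj (token_d k) _; rewrite (_ : d k = d m) ?token_d //; lia.
      by move: e2; rewrite ek; lia.
  + move=> j' dj' [k hk].
    have nj : j' != i by apply/eqP=> e; apply: ndi; rewrite -e.
    have out x : (x == a j') || (x == d j') -> ~~ (a i <= x <= d i).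
      move=> xj; apply/negP => xi.
      have nxi : ~~ ((x == a i) || (x == d i)).
        apply/negP => e; case/eqP: nj; apply: (@token_inj _ _ x); by rewrite /token orbA ?xj ?e.
      have nbi : ~~ ((x == b i) || (x == (b i).+1)) by apply/negP; apply: outer_not_inner xj.
      have := cj _ dj' (ex_intro _ k hk); have := cm _ dj' (ex_intro _ k hk).
      by move: xj xi nxi nbi aj dj am dm; clear; case/orP=> /eqP ->; lia.
    by rewrite !out ?eqxx ?orbT.
Qed.

Lemma nested_below n : (forall j, dead j -> attached j -> n <= height j) ->
  forall i, ~ dead i -> height i < n -> nested i.
Proof.
move=> le_n i; have [m] := ubnP (height i); elim: m i => // m IH i ltm ndi ltn.
apply: nested_step => // j hj ltj; apply: IH => [||]; [lia| |lia].
by move=> dj; have := le_n j dj (ex_intro _ i hj); lia.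
Qed.

(** The neighbours of the inner elements of a dead pair are an inner element of its witness [l] and
    an outer one facing the wrong way: [i] would have to end where [l] starts or start where [l]
    ends. *)
Lemma inner_half_not_dead i k : inner_half i k -> ~ dead k.
Proof.
move=> hik [l]; rewrite /height => h3 e.
have [sl al] := (sum_ad l, ab l); have [si ai] := (sum_ad i, ab i).
have oni x := @outer_not_inner i l x.
have nil x : token i x -> (x = a l \/ x = d l) -> a i = a l.
  move=> ti tx; suff -> : i = l by [].
  by apply: token_inj ti _; case: tx => ->; rewrite (token_a, token_d).
case/orP: hik => /andP[/eqP e1 /eqP e2]; case: e => e.
- have := nil (d i) (token_d i); lia.
- by apply: (oni (d i)); rewrite ?eqxx ?orbT //; apply/orP; right; apply/eqP; lia.
- by apply: (oni (a i)); rewrite ?eqxx ?orbT //; apply/orP; left; apply/eqP; lia.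
- have := nil (a i) (token_a i); lia.
Qed.

(* Take a shortest attached dead [j], and climb from the pair of height 3 around
   its inner elements.  The outer elements of [j] stay outside every ancestor
   met, so the ancestor is short enough for its parent to be nested as well, and
   the climb never ends. *)
Lemma no_attached_dead j : dead j -> ~ attached j.
Proof.
have [n] := ubnP (height j); elim: n j => // n IHn j ltn dj aj.
have le_j i : dead i -> attached i -> height j <= height i.
  move=> di ai; case: leqP => // lt_ij; case: (IHn i _ di ai); lia.
have nested_lt := nested_below le_j.
suff climb m c : N - height c < m -> ~ dead c -> nested c -> a c <= b j < d c -> False.
  have dhj := dead_height dj; case: (dj) => i hi bij.
  have ndi : ~ dead i by move=> /dead_height; lia.
  apply: (climb _ i (ltnSn _) ndi); first by apply: nested_lt => //; lia.
  by move: hi bij; rewrite /height; have := ab i; have := sum_ad i; lia.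
elim: m c => // m IHm c ltm ndc gc bjc; have [cc _ clc] := gc.
have ncj : c != j by apply/eqP=> e; apply: ndc; rewrite e.
have [_ _ [_ _ nb1] [_ _ nb2 nb3]] := disjoint_tokens ncj.
have /andP[naj ndj] := clc j dj aj.
have [sj abj] := (sum_ad j, ab j); have [sc abc] := (sum_ad c, ab c); have dlc := d_le c.
(* Both spans are centred at their inner elements, and the two centres are at least 2 apart, so
   lying strictly inside the span of [j] costs 3 in height. Then every half of the parent of [c] is
   still shorter than [j]. *)
have lt_cj : height c + 3 <= height j by rewrite /height; lia.
have ncr : c != r by apply/eqP=> e; move: naj ndj; rewrite e root_a root_d; have := a_gt0 j; have := d_le j; lia.
have [k hk] := sealed_parent cc ncr.
have hck := inner_half_height hk.
have ndk := inner_half_not_dead hk.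
apply: (IHm k) => //; first by move: ltm hck; rewrite /height; lia.
  apply: nested_step => // l hl _; apply: nested_lt; last by case: (half_height hl); lia.
  by move=> dl; have := le_j l dl (ex_intro _ k hl); case: (half_height hl); lia.
by move: hk; rewrite /inner_half; have := ab k; have := sum_ad k; lia.
Qed.

Lemma all_nested i : ~ dead i -> nested i.
Proof.
by move=> ndi; apply: (@nested_below (height i).+1) => // j dj /(no_attached_dead dj).
Qed.

(** * Leaves, and the contradiction at the root *)

Lemma root_height i : ~ dead i -> exists e, height r + 3 = (height i + 3) * 2 ^ e.
Proof.
have [n] := ubnP (N - height i); elim: n i => // n IH i ltn ndi.
have [->|nr] := eqVneq i r; first by exists 0; rewrite muln1.
have [ci _ _] := all_nested ndi; have [k hk] := sealed_parent ci nr.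
have := inner_half_height hk => hki.
have [|e he] := IH k _ (inner_half_not_dead hk).
  by move: ltn hki; rewrite /height; have := ab i; have := sum_ad i; have := d_le i; lia.
by exists e.+1; rewrite he hki expnS mulnA; congr (_ * _); lia.
Qed.

Lemma exists_leaf (i : I) : exists j, height j = 2 \/ height j = 3.
Proof.
have [n] := ubnP (height i); elim: n i => // n IH i ltn.
case: (classify i) => [h|[j h _]|[h _]|[h3 [j [m /and3P [aj dm bjm]]]]];
  [by exists i; left|by exists j; right|by exists i; right|].
have hj : is_half j i by move: aj bjm; rewrite /is_half /left_half; clear; lia.
by apply: (IH j); case: (half_height hj); lia.
Qed.

Lemma weight_ab k l : (weight k (a l) + weight k (b l) = 0)%R.
Proof.
have [->|ne] := eqVneq k l; first by rewrite weight_outer ?weight_inner ?eqxx.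
by rewrite !weight_none // (@token_neq l) // 1?eq_sym // (token_b, token_a).
Qed.

(* An unattached dead pair can only cancel its outer adjacencies by having its
   least element in one of the two one-element gaps of a pair of height 2. *)
Lemma five_of_dead i : dead i -> exists k, height k = 2.
Proof.
move=> di; have nai := no_attached_dead di.
have hi0 := a_gt0 i; have hi1 := ab i; have hi2 := sum_ad i; have hi3 := d_le i.
have [|k tk] := @token_cover (a i).+1; first by lia.
have nk : k != i by apply: contraTneq tk => ->; rewrite /token; lia.
have {nai} nai : ~~ is_half i k by apply/negP=> h; apply: nai; exists k.
exists k; have [sk abk] := (sum_ad k, ab k).
have := flat (i:=i) (k:=k); rewrite eq_sym nk => /(_ isT).
(* These two neighbours are an outer and an inner element of the witness [l], of opposite weight for
   every [k]. *)
have -> : (weight k (b i).-1 + weight k (b i).+2 = 0)%R.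
  case: di => l; rewrite /height; have [sl abl] := (sum_ad l, ab l) => h3 [e|e].
    by rewrite -e (_ : (b i).-1 = a l) ?weight_ab //; lia.
  rewrite e (_ : (b l).+2.+2 = d l) /= -?weight_ad -?weight_bc; last by lia.
  by rewrite addrC weight_ab.
have bf1 := @weight_beforeP i k (a i).-1 nk; rewrite prednK ?token_a // in bf1.
have bf2 := @weight_beforeP i k (d i).-1 nk; rewrite prednK ?token_d // in bf2; last by lia.
have af1 := weight_afterP nk (token_a i); have af2 := weight_afterP nk (token_d i).
move: nai; rewrite /is_half /left_half /right_half /height => nai.
case: af1 => e1; last by rewrite tk in e1.
all: case: (bf1 isT) => e2; case: (bf2 isT) => e3; case: af2 => e4 w //; lia.
Qed.

(** Without height 3 nothing is dead, so all pairs are nested. The pair covering the gap after [a i]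
    is then sealed, although one of its ends touches [i] and [i] is too short to contain it as an
    inner half. *)
Lemma seven_of_five i : height i = 2 -> exists k, height k = 3.
Proof.
move=> h2; have hi0 := a_gt0 i; have hi1 := ab i; have hi2 := sum_ad i; have hi3 := d_le i.
have [/existsP [l /eqP h3]|no7] := boolP [exists l, height l == 3]; first by exists l.
have [|k tk] := @token_cover (a i).+1; first by lia.
have ea : b i = (a i).+2 by move: h2; rewrite /height; lia.
have nk : k != i by apply: contraTneq tk => ->; rewrite /token; lia.
have [ck _ _] : nested k.
  by apply: all_nested => -[l h3 _]; case/existsP: no7; exists l; apply/eqP.
rewrite eq_sym in nk.
have [/inner_half_height|[na nd]] := sealed_cases ck nk.
  by move: h2; rewrite /height; have := ab k; lia.
exfalso; case/or4P: tk => /eqP e.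
- by move: na; rewrite -e token_a.
- by move: nd; rewrite -e -ea token_b.
- by case/eqP: nk; apply: token_inj (token_b i) _; rewrite ea e token_c.
- by case/eqP: nk; apply: token_inj (token_a i) _; case: e => ->; rewrite token_b.
Qed.

Lemma flat_absurd : False.
Proof.
have [seven [five [h3 h2]]] : exists k l, height k = 3 /\ height l = 2.
  have [i [h|h]] := exists_leaf r.
    by have [k hk] := seven_of_five h; exists k, i.
  (* A leaf of height 3 is flanked by inner elements of other pairs, which it makes dead; these in
     turn yield a pair of height 2. *)
  have ndi : ~ dead i by move=> /dead_height; lia.
  case: (classify i) => [|/ndi //|[_ [j [m [hj _]]]]|[]]; [lia| |lia].
  have [|l hl] := @five_of_dead j; last by exists i, l.
  by exists i => //; left.
have [|e he] := @root_height seven; first by move=> /dead_height; lia.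
have [|f hf] := @root_height five; first by move=> /dead_height; lia.
(* The two expressions for the root say 6 * 2 ^ e = 5 * 2 ^ f, impossible modulo 3. *)
have : 3 %| (height five + 3) * 2 ^ f by rewrite -hf he h3 dvdn_mulr.
by rewrite h2 Euclid_dvdM // Euclid_dvdX.
Qed.

End FlatConfiguration.

(** * Random signs *)

Section SignForm.
Variables (I : finType) (M : I -> I -> int).
Local Open Scope ring_scope.

Definition sign_form (e : {ffun I -> bool}) : int :=
  \sum_i \sum_j (-1) ^+ e i * (-1) ^+ e j * M i j.

(** Flipping the sign of [i] alone is an involution that negates each summand. *)
Lemma sum_sign_neq (i j : I) : i != j ->
  \sum_(e : {ffun I -> bool}) (-1) ^+ e i * (-1) ^+ e j = 0 :> int.
Proof.
move=> ne; set S := LHS.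
pose flip (e : {ffun I -> bool}) : {ffun I -> bool} := [ffun k => e k (+) (k == i)].
have flipK : involutive flip by move=> e; apply/ffunP=> k; rewrite !ffunE -addbA addbb addbF.
have : S = - S.
  rewrite {1}/S (reindex_inj (can_inj flipK)) -sumrN; apply: eq_bigr => e _.
  by rewrite !ffunE eqxx eq_sym (negbTE ne) addbF addbT; case: (e i); case: (e j).
lia.
Qed.

Lemma sum_sign_form :
  \sum_e sign_form e = #|{ffun I -> bool}|%:R * \sum_i M i i.
Proof.
rewrite exchange_big mulr_sumr; apply: eq_bigr => i _ /=.
rewrite exchange_big (bigD1 i) //= [X in _ + X]big1 => [|j ne].
  rewrite addr0 -mulr_suml; congr (_ * _).
  rewrite (eq_bigr (fun=> 1)) ?sumr_const // => e _; by case: (e i).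
by rewrite -mulr_suml sum_sign_neq ?mul0r // eq_sym.
Qed.

(* The average of [sign_form] is the trace, so if it is never smaller it is
   constant, and then its second differences 4 * (M i k + M k i) vanish. *)
Lemma sign_form_lt_or_flat :
  (exists e, sign_form e < \sum_i M i i) \/
  (forall e, sign_form e = \sum_i M i i) /\
  (forall i k, i != k -> M i k + M k i = 0).
Proof.
set T := \sum_i M i i.
have [/existsP [e lt_e]|] := boolP [exists e, sign_form e < T]; first by left; exists e.
rewrite negb_exists => /forallP ge_T; right.
have const e : sign_form e = T.
  apply/eqP; rewrite -subr_eq0; apply/eqP.
  apply: (@psumr_eq0P _ _ predT (fun e => sign_form e - T)) => // [f _|].
    by rewrite subr_ge0 leNgt.
  by rewrite sumrB sum_sign_form sumr_const mulr_natl subrr.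
split=> // i k ne.
pose E (u v : bool) : {ffun I -> bool} := [ffun x => u && (x == i) || v && (x == k)].
have : sign_form (E false false) - sign_form (E true false)
       - sign_form (E false true) + sign_form (E true true) = 4 * (M i k + M k i).
  rewrite -!sumrB -big_split /=.
  have sumE (u v : I) : \sum_x \sum_y ((x == u) && (y == v))%:R * M x y = M u v.
    rewrite (bigD1 u) //= (bigD1 v) //= !eqxx mul1r !big1 ?addr0 // => [x /negbTE nx|y /negbTE ny].
      by apply: big1 => y _; rewrite nx mul0r.
    by rewrite ny mul0r.
  rewrite -(sumE i k) -(sumE k i) -big_split mulr_sumr; apply: eq_bigr => x _ /=.
  rewrite -!sumrB -!big_split mulr_sumr /=; apply: eq_bigr => y _ /=.
  rewrite !ffunE /=.
  have : ~~ ((x == i) && (x == k)) by apply: contra ne => /andP[/eqP <-].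
  have : ~~ ((y == i) && (y == k)) by apply: contra ne => /andP[/eqP <-].
  by case: (x == i) (x == k) (y == i) (y == k) => [] [] [] [] //= _ _;
    rewrite /= ?expr0 ?expr1; ring.
rewrite !const; lia.
Qed.
End SignForm.

Lemma sum_range m N : (\sum_(x < N) (0 < x <= m)%:Z = (minn m N.-1)%:Z)%R.
Proof.
by elim: N => [|N IH]; rewrite ?big_ord0 ?minn0 // big_ord_recr /= IH; lia.
Qed.

Lemma telescope (F : nat -> int) m :
  (\sum_(x < m.+1) (if (0 < x)%N then F x - F x.+1 else 0) = F 1%N - F m.+1)%R.
Proof.
elim: m => [|m IH]; first by rewrite big_ord1 subrr.
by rewrite big_ord_recr IH /=; ring.
Qed.

Lemma sum_posz (P : nat -> bool) N : (\sum_(x < N) (P x)%:Z = (\sum_(x < N) P x)%N%:Z)%R.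
Proof. by rewrite -(big_morph Posz PoszD (erefl _)). Qed.

(** * Descents of a signing *)

Section Descents.
Variables (t : nat) (a b c d : 'I_t -> nat).
Local Notation n := (4 * t)%N.
Hypothesis a_gt0 : forall i, 0 < a i.
Hypothesis ab : forall i, a i < b i.
Hypothesis bc : forall i, b i < c i.
Hypothesis cd : forall i, c i < d i.
Hypothesis d_le : forall i, d i <= n.
Hypothesis sum_ad : forall i, a i + d i = b i + c i.
Definition block i x := [|| x == a i, x == d i, x == b i | x == c i].
Hypothesis block_cover : forall x, 0 < x <= n -> exists i, block i x.
Hypothesis block_inj : forall i j x, block i x -> block j x -> i = j.

Definition block_sign i x : int := ((x == a i) + (x == d i))%:Z - ((x == b i) + (x == c i))%:Z.
Local Notation g := block_sign.

Definition signing (e : {ffun 'I_t -> bool}) x : int := (\sum_i (-1) ^+ e i * g i x)%R.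

Lemma block_sign_pm i x : block i x -> g i x = 1 \/ g i x = (-1)%R.
Proof.
have := ab i; have := bc i; have := cd i; rewrite /block /g => *.
have : g i x = 1 \/ g i x = (-1)%R by rewrite /g; lia.
by [].
Qed.

Lemma block_sign0 i x : ~~ block i x -> g i x = 0.
Proof. rewrite /block /g; lia. Qed.

Lemma signing_block e i x : block i x -> signing e x = ((-1) ^+ e i * g i x)%R.
Proof.
move=> ix; rewrite /signing (bigD1 i) //= big1 ?addr0 // => j ne.
rewrite block_sign0 ?mulr0 //; apply/negP => jx; case/eqP: ne; exact: block_inj jx ix.
Qed.

Lemma signing_pm e x : 0 < x <= n -> signing e x = 1 \/ signing e x = (-1)%R.
Proof.
case/block_cover=> i ix; rewrite (signing_block _ ix).
by case: (block_sign_pm ix) => ->; case: (e i); [right|left|left|right]; rewrite /= ?expr0 ?expr1; lia.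
Qed.

(** Thanks to this, sums may include the index 0, and shifts beyond [n] contribute nothing. *)
Lemma signing0 e x : ~~ (0 < x <= n) -> signing e x = 0.
Proof.
move=> nx; rewrite /signing big1 // => i _; rewrite block_sign0 ?mulr0 //.
have [[[[? ?] ?] ?] ?] := (a_gt0 i, ab i, bc i, cd i, d_le i); move: nx; rewrite /block; lia.
Qed.

Lemma sum_block_sign i (h : nat -> int) :
  (\sum_(x < n.+1) g i x * h x = h (a i) + h (d i) - h (b i) - h (c i))%R.
Proof.
have pick (u : nat) : u <= n -> (\sum_(x < n.+1) ((x : nat) == u)%:Z * h x = h u)%R.
  rewrite -ltnS => lt_u; rewrite (bigD1 (Ordinal lt_u)) //= eqxx mul1r big1 ?addr0 // => x ne.
  by rewrite (_ : (x : nat) == u = false) ?mul0r //; apply: contraNF ne.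
have := (ab i, bc i, cd i, d_le i) => -[[[? ?] ?] ?].
rewrite -(pick (a i)) -?(pick (b i)) -?(pick (c i)) -?(pick (d i)); try lia.
rewrite -!sumrN -!big_split /=; apply: eq_bigr => x _.
rewrite /g !PoszD; ring.
Qed.

Definition opposite (e : {ffun 'I_t -> bool}) := [ffun i => ~~ e i].

Lemma signing_opposite e x : signing (opposite e) x = (- signing e x)%R.
Proof.
rewrite /signing -sumrN; apply: eq_bigr => i _; rewrite ffunE.
by case: (e i); rewrite /= ?expr0 ?expr1; ring.
Qed.

(** * Descents at distance [p] *)

Section Shift.
Variable p : nat.

(** This is the correlation of two blocks, the sum over [x] of [g i x * g j (x + p)]. *)
Definition shift_form i j : int := (g j (a i + p)%N + g j (d i + p)%N - g j (b i + p)%N - g j (c i + p)%N)%R.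

Lemma signing_form e :
  (\sum_(x < n.+1) signing e x * signing e (x + p)%N = sign_form shift_form e)%R.
Proof.
rewrite (eq_bigr (fun x : 'I_n.+1 => \sum_i \sum_j
   (-1) ^+ e i * (-1) ^+ e j * (g i x * g j (x + p)%N)))%R; last first.
  move=> x _; rewrite mulr_suml; apply: eq_bigr => i _; rewrite mulr_sumr.
  by apply: eq_bigr => j _; ring.
rewrite exchange_big /=; apply: eq_bigr => i _; rewrite exchange_big /=.
apply: eq_bigr => j _; rewrite -mulr_sumr.
by rewrite (sum_block_sign i (fun x => g j (x + p)%N)).
Qed.

Definition descent e x := (signing e x == 1) && (signing e (x + p) == (-1)%R).

Hypothesis p_gt0 : 0 < p.

(** For [0 < x <= n - p] the product of the signs at [x] and [x + p] is -1 at a descent or an ascent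
    and 1 otherwise. Ascents are the descents of the opposite signing. *)
Lemma descent_count e :
  (2 * (\sum_(x < n.+1) (descent e x)%:Z + \sum_(x < n.+1) (descent (opposite e) x)%:Z)
   = (n - p)%:Z - sign_form shift_form e)%R.
Proof.
rewrite -signing_form -big_split mulr_sumr /=.
have -> : ((n - p)%:Z = \sum_(x < n.+1) (0 < x <= n - p)%:Z)%R.
  by rewrite sum_range; congr Posz; lia.
rewrite -sumrB; apply: eq_bigr => x _; rewrite /descent !signing_opposite.
have := ltn_ord x; rewrite ltnS => xn.
have [x0|x0] := boolP (0 < x <= n - p).
  have [|e1|e1] := @signing_pm e x; first by lia.
    have [|e2|e2] := @signing_pm e (x + p); first by lia.
      by rewrite e1 e2.
    by rewrite e1 e2.
  have [|e2|e2] := @signing_pm e (x + p); first by lia.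
    by rewrite e1 e2.
  by rewrite e1 e2.
have [x1|x1] := boolP (0 < x); last by rewrite (@signing0 e x) //; lia.
by rewrite (@signing0 e (x + p)) ?oppr0 ?andbF ?mulr0 //; lia.
Qed.

(** Only [a i + p = d i] and [b i + p = c i] count positively, and they exclude each other because
    [c i - b i < d i - a i]. *)
Lemma shift_form_diag i : (shift_form i i <= 1)%R.
Proof.
have [[[? ?] ?] ?] := (ab i, bc i, cd i, sum_ad i).
have h1 : (g i (a i + p)%N <= (a i + p == d i)%N%:Z)%R by rewrite /g; lia.
have h2 : (g i (d i + p)%N <= 0)%R by rewrite /g; lia.
have h3 : (- (b i + p == c i)%N%:Z <= g i (b i + p)%N)%R by rewrite /g; lia.
have h4 : (0 <= g i (c i + p)%N)%R by rewrite /g; lia.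
rewrite /shift_form.
lia.
Qed.

Lemma some_descents : exists e, 3 * t <= 4 * (\sum_(x < n.+1) descent e x) + p.
Proof.
have [e le_e] : exists e, (sign_form shift_form e <= t%:Z)%R.
  have le_t : (\sum_i shift_form i i <= t%:Z)%R.
    have : (\sum_i shift_form i i <= \sum_(i < t) 1)%R by apply: ler_sum => i _; apply: shift_form_diag.
    by rewrite sumr_const card_ord natz.
  have [[e lt_e]|[eq_e _]] := sign_form_lt_or_flat shift_form.
    by exists e; apply: le_trans (ltW lt_e) le_t.
  by exists [ffun=> false]; rewrite eq_e.
(* Descents and ascents together number at least (3t - p)/2, so the more frequent kind suffices. *)
have := descent_count e; rewrite !sum_posz => ce.
have [h|h] := leqP (\sum_(x < n.+1) descent (opposite e) x) (\sum_(x < n.+1) descent e x);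
  [exists e | exists (opposite e)]; lia.
Qed.

End Shift.

(** * Distance one on the cycle *)

Hypothesis t_gt0 : 0 < t.

(* Closing the path 1, ..., n into a cycle accounts for the difference between
   the numbers of descents and of ascents. *)
Definition cyclic_form i j : int := (shift_form 1 i j + g i n * g j 1%N)%R.

Lemma cyclic_form_sum e : (sign_form cyclic_form e =
  sign_form (shift_form 1) e + signing e n * signing e 1%N)%R.
Proof.
rewrite /sign_form /signing mulr_suml -big_split /=; apply: eq_bigr => i _.
rewrite mulr_sumr -big_split /=; apply: eq_bigr => j _.
rewrite /cyclic_form; ring.
Qed.

Lemma cyclic_descents e : exists e', (4 * (\sum_(x < n.+1) descent 1 e' x)%:Z =
  n%:Z - sign_form cyclic_form e)%R.
Proof.
have pm f x : 0 < x <= n -> signing f x = 1 \/ signing f x = (-1)%R by exact: signing_pm.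
have s0 f x : ~~ (0 < x <= n) -> signing f x = 0 by exact: signing0.
(* Once the sign at 1 is +, the closing edge from [n] to 1 is no descent, so the descents of the
   path are exactly half of the sign changes on the cycle. *)
wlog e1 : e / signing e 1%N = 1.
  move=> H; have [|/H //|e1] := pm e 1%N; first by lia.
  have [|e' he'] := H (opposite e); first by rewrite signing_opposite e1.
  exists e'; rewrite he'; congr (_ - _)%R; rewrite /sign_form; apply: eq_bigr => i _; apply: eq_bigr => j _.
  by rewrite !ffunE; case: (e i); case: (e j); rewrite /= ?expr0 ?expr1; ring.
exists e; rewrite cyclic_form_sum e1 mulr1.
have : (2 * (\sum_(x < n.+1) (descent 1 e x)%:Z
    + \sum_(x < n.+1) (descent 1 (opposite e) x)%:Z)
   = (n - 1)%:Z - sign_form (shift_form 1) e)%R by exact: descent_count.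
rewrite !sum_posz => ce.
have tel : (2 * (\sum_(x < n.+1) (descent 1 e x)%:Z - \sum_(x < n.+1) (descent 1 (opposite e) x)%:Z)
  = signing e 1%N - signing e n)%R.
  rewrite -sumrB mulr_sumr.
  rewrite (eq_bigr (fun x : 'I_n.+1 => if (0 < x < n)%N then signing e x - signing e x.+1 else 0)%R).
    have [m em] : exists m, n = m.+1 by exists n.-1; lia.
    rewrite big_ord_recr /= ltnn andbF addr0 em -(telescope (signing e)).
    by apply: eq_bigr => x _; rewrite ltn_ord andbT.
  move=> x _; rewrite /descent !signing_opposite addn1.
  have [x0|x0] := boolP (0 < x < n).
    have [|e1'|e1'] := pm e x; have [|e2|e2] := pm e x.+1; try lia; by rewrite e1' e2.
  have := ltn_ord x; rewrite ltnS => xn.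
  have [x1|x1] := boolP (0 < x); last by rewrite (@s0 e x) //; lia.
  by rewrite (@s0 e x.+1) ?oppr0 ?andbF ?mulr0 //; lia.
move: tel; rewrite !sum_posz e1; lia.
Qed.

(** Inside a block, the adjacency of [b i] and [c i] and the closing edge count positively, those of
    [a i] with [b i] and [c i] with [d i] negatively. *)
Lemma cyclic_form_diag i :
  (cyclic_form i i <= 1 + ((a i == 1%N) && (d i == n))%:Z)%R /\
  (cyclic_form i i = 1 + ((a i == 1%N) && (d i == n))%:Z ->
    c i = (b i).+1 /\ (a i + 2 <= b i)%N)%R.
Proof.
have [[[? ?] ?] ?] := (ab i, bc i, cd i, sum_ad i); have := d_le i; have := a_gt0 i => *.
have h1 : (g i (a i + 1)%N = - (b i == (a i).+1)%:Z)%R by rewrite /block_sign; lia.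
have h2 : (g i (d i + 1)%N = 0)%R by rewrite /block_sign; lia.
have h3 : (g i (b i + 1)%N = - (c i == (b i).+1)%:Z)%R by rewrite /block_sign; lia.
have h4 : (g i (c i + 1)%N = (d i == (c i).+1)%:Z)%R by rewrite /block_sign; lia.
have h5 : (g i n = (d i == n)%:Z)%R by rewrite /block_sign; lia.
have h6 : (g i 1%N = (a i == 1%N)%:Z)%R by rewrite /block_sign; lia.
rewrite /cyclic_form /shift_form h1 h2 h3 h4 h5 h6; split; lia.
Qed.

(** The correlation sum is reindexed by the later of the two adjacent elements; the index 0 is
    harmless because [g i] vanishes there. *)
Lemma shift_form_before k i : (shift_form 1 k i =
  g k (a i).-1 + g k (d i).-1 - g k (b i).-1 - g k (c i).-1)%R.
Proof.
pose G y := (g i y * g k y.-1)%R.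
have g0 y : ~~ (0 < y <= n) -> G y = 0.
  move=> ny; rewrite /G block_sign0 ?mul0r //.
  have [[[[? ?] ?] ?] ?] := (a_gt0 i, ab i, bc i, cd i, d_le i); move: ny; rewrite /block; lia.
rewrite /shift_form -(sum_block_sign i (fun y => g k y.-1)) -(sum_block_sign k (fun y => g i (y + 1)%N)).
have shift0 : (\sum_(y < n.+2) G y = \sum_(x < n.+1) G x.+1)%R.
  by rewrite big_ord_recl g0 ?add0r.
have shiftn : (\sum_(y < n.+2) G y = \sum_(y < n.+1) G y)%R.
  by rewrite big_ord_recr /= g0 ?addr0 // ltnn andbF.
rewrite -[RHS]shiftn shift0; apply: eq_bigr => x _.
by rewrite /G addn1 mulrC.
Qed.

(** The closing edge joins two elements of [r], so it contributes nothing to distinct blocks, and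
    the adjacency of [b i] with [c i] does not involve [k]. *)
Lemma cyclic_form_net r i k : a r = 1 -> d r = n -> (forall j, c j = (b j).+1) -> i != k ->
  (cyclic_form i k + cyclic_form k i =
   g k (a i).-1 + g k (a i).+1 + g k (d i).-1 + g k (d i).+1
   - g k (b i).-1 - g k (b i).+2)%R.
Proof.
move=> ar dr cb ne; rewrite /cyclic_form (shift_form_before k i) /shift_form.
have gk x : block i x -> g k x = 0.
  move=> ix; apply: block_sign0; apply/negP => kx; case/eqP: ne; exact: block_inj ix kx.
have wrap u v : u != v -> (g u n * g v 1%N = 0)%R.
  move=> nuv; have [eu|/block_sign0->] := boolP (block u n); last by rewrite mul0r.
  rewrite [g v _]block_sign0 ?mulr0 //; apply/negP => ev; case/eqP: nuv.
  have -> : u = r by apply: block_inj eu _; rewrite /block dr eqxx orbT.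
  by apply: block_inj _ ev; rewrite /block ar eqxx.
rewrite !wrap // 1?eq_sym // cb !addn1 /=.

rewrite (gk (b i).+1) ?(gk (b i)); first ring.
- by rewrite /block eqxx !orbT.
- by rewrite /block cb eqxx !orbT.
Qed.

Lemma some_unit_descents : exists e, 3 * t <= 4 * (\sum_(x < n.+1) descent 1 e x).
Proof.
suff [e le_e] : exists e, (sign_form cyclic_form e <= t%:Z)%R.
  by have [e' he] := cyclic_descents e; exists e'; lia.
have [|lt_t] := leP (\sum_i cyclic_form i i)%R (Posz t).
  move=> le_t; have [[e lt_e]|[eq_e _]] := sign_form_lt_or_flat cyclic_form.
    by exists e; apply: le_trans (ltW lt_e) le_t.
  by exists [ffun=> false]; rewrite eq_e.
have [/existsP [r /andP[/eqP ar /eqP dr]]|nr] := boolP [exists i, (a i == 1) && (d i == n)]; last first.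
  suff : (\sum_i cyclic_form i i <= t%:Z)%R by rewrite leNgt lt_t.
  have -> : (t%:Z = \sum_(i < t) 1)%R by rewrite sumr_const card_ord natz.
  apply: ler_sum => i _; have [+ _] := cyclic_form_diag i.
  by move: nr; rewrite negb_exists => /forallP /(_ i) /negbTE ->; rewrite addr0.
have root i : (a i == 1) && (d i == n) = (i == r).
  apply/andP/eqP => [[/eqP ai _]|->]; last by rewrite ar dr !eqxx.
  by apply: (@block_inj _ _ 1); rewrite /block ?ai ?ar eqxx.
have sum1r : (\sum_(i < t) (1 + (i == r)%:Z) = t%:Z + 1)%R.
  rewrite big_split /= sumr_const card_ord natz (bigD1 r) //= eqxx big1 ?addr0 //.
  by move=> i /negbTE ->.
(* The entries are at most [1 + (i == r)], with sum [t + 1], while the trace exceeds [t]; hence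
   equality holds everywhere. *)
have diag i : cyclic_form i i = (1 + (i == r)%:Z)%R.
  apply/eqP; rewrite eq_sym -subr_eq0; apply/eqP.
  apply: (@psumr_eq0P _ _ predT (fun i => 1 + (i == r)%:Z - cyclic_form i i)%R) => // [j _|].
    by rewrite subr_ge0 -root; case: (cyclic_form_diag j).
  apply/eqP; rewrite eq_le; apply/andP; split; last first.
    by apply: sumr_ge0 => j _; rewrite subr_ge0 -root; case: (cyclic_form_diag j).
  rewrite sumrB sum1r subr_le0 lezD1; exact: lt_t.
have sumd : (\sum_i cyclic_form i i = t%:Z + 1)%R by rewrite -sum1r; apply: eq_bigr => i _.
have shape i : c i = (b i).+1 /\ a i + 2 <= b i.
  by case: (cyclic_form_diag i) => _; apply; rewrite root diag.
(* Beating the average [t + 1] already means at most [t], by integrality; otherwise the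
   configuration is flat. *)
have [[e lt_e]|[_ flat]] := sign_form_lt_or_flat cyclic_form.
  by exists e; lia.
exfalso; apply: (@flat_absurd _ n a b d r) => //.
- by move=> i; case: (shape i).
- by move=> i; rewrite sum_ad; case: (shape i) => ->.
- by move=> x /block_cover [i]; exists i; rewrite /token; case: (shape i) => <-.
- by move=> i j x; rewrite /token; case: (shape i) (shape j) => <- _ [<- _]; apply: block_inj.
- move=> i k ne; have := flat i k ne; rewrite (cyclic_form_net ar dr) //; last by move=> j; case: (shape j).
  have wE x : weight a b d k x = g k x by rewrite /weight /block_sign; case: (shape k) => ->.
  by rewrite !wE => /eqP; rewrite -addrA -opprD subr_eq0 => /eqP.
Qed.

End Descents.

(** * From descents to discrepancy *)

Section Swaps.
Variables (t p : nat) (up : pred 'I_(4 * t)) (next : 'I_(4 * t) -> 'I_(4 * t)).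
Hypothesis p_gt0 : 0 < p.
Hypothesis next_up : forall x, up x -> label (next x) = label x + p.
Hypothesis up_next : forall x, up x -> ~~ up (next x).

Definition up_swaps : {set {set 'I_(4 * t)}} := [set [set x; next x] | x in up].

Lemma up_swapsP x y : reflect (up x /\ y = next x \/ up y /\ x = next y)
  ([set x; y] \in up_swaps).
Proof.
apply: (iffP imsetP) => [[z uz0 /setP e]|[[ux ->]|[uy ->]]]; last first.
- by exists y => //; rewrite setUC.
- by exists x.
have uz : up z := uz0.
have nz : next z != z.
  by apply/eqP => nzz; have := up_next uz; rewrite nzz uz.
have := e x; have := e y; have := e z; have := e (next z); rewrite !inE !eqxx ?orbT /=.
case: (eqVneq x z) => [->|nx]; case: (eqVneq y z) => [->|ny] /=; rewrite ?eqxx ?orbT ?orbF ?(negbTE nz) //=.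
- by move=> /eqP -> _ _ _; left.
- by move=> + _ _ _; rewrite orbF => /eqP ->; right.
Qed.

(** The swaps are disjoint: [next] is a translation on [up], hence injective, and its values there
    avoid [up]. *)
Lemma up_swaps_inj x y z : [set x; y] \in up_swaps -> [set x; z] \in up_swaps -> y = z.
Proof.
have next_inj u v : up u -> up v -> next u = next v -> u = v.
  move=> uu uv e; apply: val_inj; have := next_up uu; have := next_up uv.
  by rewrite e /label /=; lia.
case/up_swapsP => [[ux ->]|[uy ->]] /up_swapsP [[ux' e]|[uz e]] //.
- by move: (up_next uz); rewrite -e ux.
- by move: (up_next uy); rewrite ux'.
- exact: next_inj e.
Qed.

Lemma up_swaps_swap_sets : up_swaps \in swap_sets t p.
Proof.
rewrite inE; apply/and3P; split.
- apply/forall_inP => e /imsetP [x ux0 ->]; rewrite cards2.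
  have ux : up x := ux0; case: (eqVneq x (next x)) => // e0.
  by have := up_next ux; rewrite -e0 ux.
- apply/trivIsetP => A B AI BI; apply: contraR => /pred0Pn [z /andP /= [zA zB]].
  have pair C : C \in up_swaps -> z \in C -> exists y, C = [set z; y].
    move=> /imsetP [x _ ->]; rewrite !inE => /orP [] /eqP ->; first by exists (next x).
    by exists x; rewrite setUC.
  have [u eA] := pair _ AI zA; have [v eB] := pair _ BI zB.
  by rewrite eA eB (@up_swaps_inj z u v) // -?eA -?eB.
- apply/forall_inP => e /imsetP [x ux ->]; apply/forall_inP => u + .
  have := next_up ux; rewrite !inE => nx ue; apply/forall_inP => v; rewrite !inE.
  by move: ue => /orP [] /eqP -> /orP [] /eqP ->; lia.
Qed.

Lemma swap_label_up x : up x -> swap_label up_swaps x = next x.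
Proof.
move=> ux; rewrite /swap_label; case: pickP => [y|/(_ (next x))] /=.
  by move=> h; apply: (@up_swaps_inj x) h _; apply/up_swapsP; left.
by have /up_swapsP -> : up x /\ next x = next x \/ up (next x) /\ x = next (next x) by left.
Qed.

Lemma swap_label_next x : up x -> swap_label up_swaps (next x) = x.
Proof.
move=> ux; rewrite /swap_label; case: pickP => [y|/(_ x)] /=.
  by move=> h; apply: (@up_swaps_inj (next x)) h _; apply/up_swapsP; right.
by have /up_swapsP -> : up (next x) /\ x = next (next x) \/ up x /\ next x = next x by right.
Qed.

Lemma swap_label_fix x : ~~ up x -> (forall y, up y -> x <> next y) -> swap_label up_swaps x = x.
Proof.
move=> nx ny; rewrite /swap_label; case: pickP => //= y /up_swapsP [[ux]|[uy /ny //]].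
by rewrite ux in nx.
Qed.

Definition down y := [exists x, up x && (y == next x)].

Lemma swap_labelK : involutive (swap_label up_swaps).
Proof.
move=> x; have [ux|nx] := boolP (up x); first by rewrite (swap_label_up ux) swap_label_next.
have [/existsP [y /andP [uy /eqP ->]]|nd] := boolP (down x).
  by rewrite (swap_label_next uy) swap_label_up.
rewrite !swap_label_fix // => y uy e;
  by case/negP: nd; apply/existsP; exists y; rewrite uy e eqxx.
Qed.

Lemma label_swap x : ((label (swap_label up_swaps x))%:Z =
  (label x)%:Z + p%:Z * (up x)%:Z - p%:Z * (down x)%:Z)%R.
Proof.
have [ux|nx] := boolP (up x).
  rewrite (swap_label_up ux) next_up //.
  have -> : down x = false.
    by apply/existsP => -[y /andP [uy /eqP e]]; move: (up_next uy); rewrite -e ux.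
  by lia.
have [/existsP [y /andP [uy /eqP e]]|nd] := boolP (down x).
  by rewrite e (swap_label_next uy) (next_up uy); lia.
rewrite swap_label_fix // => [|y uy e]; first by lia.
by case/negP: nd; apply/existsP; exists y; rewrite uy e eqxx.
Qed.

Lemma Sigma_swap (A : {set 'I_(4 * t)}) : ((Sigma (swap_label up_swaps @: A))%:Z =
  (Sigma A)%:Z + p%:Z * \sum_(x in A) ((up x)%:Z - (down x)%:Z))%R.
Proof.
rewrite /Sigma big_imset /=; last by move=> x y _ _; apply: (can_inj swap_labelK).
rewrite !(big_morph Posz PoszD (erefl _)) mulr_sumr -big_split /=.
by apply: eq_bigr => x _; rewrite label_swap; ring.
Qed.

Lemma card_down : #|down| = #|up|.
Proof.
rewrite -(card_in_imset (f := next) (D := up)).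
  apply: eq_card => y; apply/existsP/imsetP => [[x /andP[ux /eqP ->]]|[x ux ->]]; exists x => //.
  by rewrite eqxx andbT.
move=> u v uu uv e; apply: val_inj; have := next_up uu; have := next_up uv.
by rewrite e /label /=; lia.
Qed.

End Swaps.

(** * Companion sets as blocks *)

Lemma fst_companion_tnth t (S : (2 * t).-tuple {set 'I_(4 * t)}) (i : 'I_t) :
  exists k : 'I_(2 * t), k = 2 * i :> nat /\ fst_companion S i = tnth S k.
Proof.
have lt_k : 2 * i < 2 * t by have := ltn_ord i; lia.
by exists (Ordinal lt_k); rewrite (tnth_nth set0).
Qed.

Lemma snd_companion_tnth t (S : (2 * t).-tuple {set 'I_(4 * t)}) (i : 'I_t) :
  exists k : 'I_(2 * t), k = (2 * i).+1 :> nat /\ snd_companion S i = tnth S k.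
Proof.
have lt_k : (2 * i).+1 < 2 * t by have := ltn_ord i; lia.
by exists (Ordinal lt_k); rewrite (tnth_nth set0).
Qed.

Lemma companion_swap t (I : {set {set 'I_(4 * t)}}) S i :
  fst_companion (apply_swaps I S) i = swap_label I @: fst_companion S i /\
  snd_companion (apply_swaps I S) i = swap_label I @: snd_companion S i.
Proof.
have lt0 : 2 * i < 2 * t by have := ltn_ord i; lia.
have lt1 : (2 * i).+1 < 2 * t by have := ltn_ord i; lia.
rewrite /fst_companion /snd_companion.
rewrite -!(tnth_nth set0 _ (Ordinal lt0)) -!(tnth_nth set0 _ (Ordinal lt1)).
by rewrite !tnth_mktuple.
Qed.

Lemma cards2_ltn n (A : {set 'I_n}) : #|A| = 2 -> exists u v : 'I_n, u < v /\ A = [set u; v].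
Proof.
move=> /eqP /cards2P [u [v [ne ->]]].
case: (ltngtP u v) => [lt|lt|/val_inj e]; last by rewrite e eqxx in ne.
  by exists u, v.
by exists v, u; rewrite setUC.
Qed.

Lemma Sigma_set2 t (u v : 'I_(4 * t)) : u < v -> Sigma [set u; v] = label u + label v.
Proof.
by move=> lt; rewrite /Sigma big_setU1 ?big_set1 // inE -val_eqE /=; lia.
Qed.

Definition companion t (S : (2 * t).-tuple {set 'I_(4 * t)}) (s : bool) i :=
  if s then snd_companion S i else fst_companion S i.

Section Balanced.
Variables (t : nat) (S : (2 * t).-tuple {set 'I_(4 * t)}).
Hypothesis SB : S \in balanced t.

Lemma companion_inj s s' i j x : x \in companion S s i -> x \in companion S s' j ->
  s = s' /\ i = j.
Proof.
move: SB; rewrite inE => /and4P [_ /forallP disj _ _].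
have tn (u : bool) (k : 'I_t) : exists l : 'I_(2 * t), l = 2 * k + u :> nat /\ companion S u k = tnth S l.
  case: u; rewrite /companion.
    by have [l [e ->]] := snd_companion_tnth S k; exists l; split => //; rewrite e; lia.
  by have [l [e ->]] := fst_companion_tnth S k; exists l; split => //; rewrite e; lia.
have [k [ek ->]] := tn s i; have [l [el ->]] := tn s' j => xk xl.
have ekl : k = l.
  have [//|ne] := eqVneq k l; exfalso.
  by move: (forallP (disj k) l); rewrite ne /= => /disjointFr /(_ xk); rewrite xl.
have e : 2 * i + s = 2 * j + s' by rewrite -ek -el ekl.
by split; last apply: val_inj; move: e; clear; case: s; case: s' => /=; lia.
Qed.

Lemma companion_cover x : exists s i, x \in companion S s i.
Proof.
move: SB; rewrite inE => /and4P [_ _ /eqP /setP /(_ x)]; rewrite inE => /bigcupP [k _ xk] _.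
have lt_i : k %/ 2 < t by have := ltn_ord k; lia.
exists (k %% 2 == 1), (Ordinal lt_i); rewrite /companion.
case: eqP => k1.
  have [l [el ->]] := snd_companion_tnth S (Ordinal lt_i).
  by rewrite (_ : l = k) //; apply: val_inj; rewrite /= el /=; lia.
have [l [el ->]] := fst_companion_tnth S (Ordinal lt_i).
by rewrite (_ : l = k) //; apply: val_inj; rewrite /= el /=; lia.
Qed.

(** Disjoint pairs of equal sum have one inside the span of the other; [s] records which companion
    is the outer one. *)
Lemma companion_block i : exists q : bool * (nat * nat * nat * nat),
  let: (s, (a, b, c, d)) := q in
  [/\ [&& 0 < a, a < b, b < c, c < d & d <= 4 * t], a + d = b + c,
     forall x, (x \in companion S s i) = (label x == a) || (label x == d)
   & forall x, (x \in companion S (~~ s) i) = (label x == b) || (label x == c)].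
Proof.
move: (SB); rewrite inE => /and4P [/forallP card2 _ _ /forallP /(_ i) /eqP eqS].
have [k [_ ek]] := fst_companion_tnth S i; have [l [_ el]] := snd_companion_tnth S i.
have [u [v [uv eA]]] : exists u v : 'I_(4 * t), u < v /\ fst_companion S i = [set u; v].
  by apply: cards2_ltn; rewrite ek; apply/eqP.
have [w [z [wz eB]]] : exists u v : 'I_(4 * t), u < v /\ snd_companion S i = [set u; v].
  by apply: cards2_ltn; rewrite el; apply/eqP.
move: eqS; rewrite eA eB !Sigma_set2 // /label => eqS.
have nuw : u != w :> nat.
  apply/eqP => /val_inj e.
  have [] // := @companion_inj false true i i u; rewrite /companion ?eA ?eB ?e ?inE ?eqxx //.
have := ltn_ord v; have := ltn_ord z.
have set2E (r q y : 'I_(4 * t)) : (y \in [set r; q]) = (label y == label r) || (label y == label q).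
  by rewrite !inE -!val_eqE /label /= !eqSS.
have [lt|gt] := ltnP u w => *.
  exists (false, (u.+1, w.+1, z.+1, v.+1)); split; try (rewrite /label; lia); move=> x.
    by rewrite /companion eA set2E.
  by rewrite /companion eB set2E.
exists (true, (w.+1, u.+1, v.+1, z.+1)); split; try (rewrite /label; lia); move=> x.
  by rewrite /companion eB set2E.
by rewrite /companion eA set2E.
Qed.

End Balanced.

(** * Lower bound for the discrepancy *)

Lemma sum_pred (T : finType) (P : pred T) : \sum_x (P x : nat) = #|P|.
Proof.
by rewrite -sum1_card [RHS]big_mkcond; apply: eq_bigr => x _; rewrite unfold_in; case: (P x).
Qed.

(** Labels of sign + grow by [p] and those of sign - shrink by [p], and companions have opposite
    signs. So within a companion pair all changes push the difference of the sums the same way, and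
    each swap gains [p] at both of its endpoints. *)
Lemma max_discrepancy_ge_up t p S (f : 'I_(4 * t) -> int) (sg : 'I_t -> int)
    (up : pred 'I_(4 * t)) (next : 'I_(4 * t) -> 'I_(4 * t)) :
  S \in balanced t -> 0 < p ->
  (forall x, up x -> label (next x) = label x + p) ->
  (forall x, up x -> f x = 1 /\ f (next x) = (-1)%R) ->
  (forall i, sg i = 1 \/ sg i = (-1)%R) ->
  (forall s i x, x \in companion S s i -> f x = ((-1) ^+ s * sg i)%R) ->
  2 * p * #|up| <= max_discrepancy p S.
Proof.
move=> SB p_gt0 next_up f_up sg_pm f_sg.
have up_next x : up x -> ~~ up (next x).
  by move=> ux; apply/negP => /f_up [f1 _]; have [_] := f_up x ux; rewrite f1.
apply: leq_trans (leq_bigmax_cond _ (up_swaps_swap_sets p_gt0 next_up up_next)).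
set I := up_swaps up next; pose F x : nat := up x + down up next x.
have F_sum : \sum_x F x = 2 * #|up|.
  by rewrite big_split /= !sum_pred (card_down p_gt0 next_up) addnn mul2n.
have term i : p * (\sum_(x in fst_companion S i) F x + \sum_(x in snd_companion S i) F x)
   <= `|Sigma (fst_companion (apply_swaps I S) i) - Sigma (snd_companion (apply_swaps I S) i)|%N.
  have [-> ->] := companion_swap I S i.
  have eqS : Sigma (fst_companion S i) = Sigma (snd_companion S i).
    by move: SB; rewrite inE => /and4P [_ _ _ /forallP /(_ i) /eqP].
  have sumF s : (\sum_(x in companion S s i) ((up x)%:Z - (down up next x)%:Z)
      = (-1) ^+ s * sg i * (\sum_(x in companion S s i) F x)%N%:Z)%R.
    rewrite (big_morph Posz PoszD (erefl _)) mulr_sumr; apply: eq_bigr => x xs.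
    rewrite -(f_sg s i x xs) /F PoszD.
    have [ux|nux] := boolP (up x).
      have -> : down up next x = false.
        by apply/existsP => -[y /andP [uy /eqP e]]; move: (up_next y uy); rewrite -e ux.
      by have [-> _] := f_up x ux.
    have [/existsP [y /andP [uy /eqP ->]]|_] := boolP (down up next x).
      by have [_ ->] := f_up y uy.
    by rewrite mulr0.
  have := Sigma_swap p_gt0 next_up up_next (fst_companion S i).
  have := Sigma_swap p_gt0 next_up up_next (snd_companion S i).
  have sF := sumF false; have sT := sumF true; rewrite /companion in sF sT.
  rewrite sF sT -/I eqS expr0 expr1.
  by case: (sg_pm i) => -> hY hX; lia.
rewrite mulnAC mulnC -F_sum; rewrite [discrepancy _ _]/discrepancy.
apply: leq_trans; last by apply: leq_sum => i _; exact: term i.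
rewrite -big_distrr /= leq_mul2l; apply/orP; right.
rewrite [leqRHS](eq_bigr (fun i => \sum_x ((if x \in fst_companion S i then F x else 0)
  + (if x \in snd_companion S i then F x else 0)))) => [|i _].
  rewrite exchange_big /=; apply: leq_sum => x _.
  have [s [i xi]] := companion_cover SB x.
  rewrite (bigD1 i) //=; apply: leq_trans (leq_addr _ _).
  by case: s xi; rewrite /companion => ->; rewrite ?leq_addl ?leq_addr.
by rewrite [RHS]big_split; congr (_ + _); apply: big_mkcond.
Qed.

Lemma max_discrepancy_ge t p S : S \in balanced t -> 0 < t -> 0 < p ->
  p * (3 * t) <= 2 * max_discrepancy p S + 2 * p * p.-1.
Proof.
move=> SB t_gt0 p_gt0.
have [q qP] := fin_all_exists (companion_block SB).
pose s i := (q i).1; pose a i := (q i).2.1.1.1; pose b i := (q i).2.1.1.2.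
pose c i := (q i).2.1.2; pose d i := (q i).2.2.
have {}qP i : [/\ [&& 0 < a i, a i < b i, b i < c i, c i < d i & d i <= 4 * t], a i + d i = b i + c i,
     forall x, (x \in companion S (s i) i) = (label x == a i) || (label x == d i)
   & forall x, (x \in companion S (~~ s i) i) = (label x == b i) || (label x == c i)].
  by move: (qP i); rewrite /s /a /b /c /d; case: (q i) => ? [[[? ?] ?] ?].
have a_gt0 i : 0 < a i by case: (qP i) => /and5P[].
have ab i : a i < b i by case: (qP i) => /and5P[].
have bc i : b i < c i by case: (qP i) => /and5P[].
have cd i : c i < d i by case: (qP i) => /and5P[].
have d_le i : d i <= 4 * t by case: (qP i) => /and5P[].
have sum_ad i : a i + d i = b i + c i by case: (qP i).
have blockE i (x : 'I_(4 * t)) : block a b c d i (label x) = (x \in companion S true i) || (x \in companion S false i).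
  case: (qP i) => _ _ outer inner; rewrite /block orbA -outer -inner.
  by case: (s i); rewrite // orbC.
have labelP x : 0 < x <= 4 * t -> exists y : 'I_(4 * t), x = label y.
  case: x => // x lt_x; by exists (Ordinal lt_x).
have cover x : 0 < x <= 4 * t -> exists i, block a b c d i x.
  case/labelP => y ->; have [u [i yi]] := companion_cover SB y.
  by exists i; rewrite blockE; case: u yi => ->; rewrite ?orbT.
have block_range i x : block a b c d i x -> 0 < x <= 4 * t.
  by move: (a_gt0 i) (ab i) (bc i) (cd i) (d_le i); rewrite /block; lia.
have inj i j x : block a b c d i x -> block a b c d j x -> i = j.
  move=> ix; have /labelP [y ey] := block_range _ _ ix; move: ix; rewrite ey !blockE.
  by move=> /orP [] yi /orP [] yj; case: (companion_inj SB yi yj).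
(* The error [2 * p.-1] is at least [p] when [p >= 2], but is 0 for [p = 1], where the cyclic
   argument is required. *)
have [e he] : exists e, 3 * t <= 4 * (\sum_(x < (4 * t).+1) descent a b c d p e x) + 2 * p.-1.
  have [->|p1] := eqVneq p 1.
    have [e he] := some_unit_descents a_gt0 ab bc cd d_le sum_ad cover inj t_gt0.
    by exists e; rewrite addn0.
  have [e he] := some_descents a_gt0 ab bc cd d_le sum_ad cover inj p_gt0.
  by exists e; lia.
pose up (x : 'I_(4 * t)) := descent a b c d p e (label x).
(* The default [x] is never met on [up]: the sign at [x + p] is -1 there, hence this label lies in
   range. *)
pose next (x : 'I_(4 * t)) := insubd x (x + p).
have f0 x : ~~ (0 < x <= 4 * t) -> signing a b c d e x = 0 by exact: signing0.
have next_up x : up x -> label (next x) = label x + p.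
  rewrite /up /descent => /andP [_ /eqP ds].
  rewrite /label /next val_insubd; case: ifP => //= /negbT nlt.
  by move: ds; rewrite f0 // /label; lia.
have card_up : \sum_(x < (4 * t).+1) descent a b c d p e x = #|up|.
  by rewrite big_ord_recl /= {1}/descent f0 // add0n -sum_pred.
have : 2 * p * #|up| <= max_discrepancy p S.
  apply: (@max_discrepancy_ge_up t p S (fun x => signing a b c d e (label x))
    (fun i => (-1) ^+ e i * (-1) ^+ s i)%R up next) => //.
  - by move=> x ux; rewrite next_up //; move/andP: ux => [/eqP -> /eqP ->].
  - by move=> i; case: (e i); case: (s i); rewrite /= ?expr0 ?expr1; [left|right|right|left].
  move=> u i x xi; have ix : block a b c d i (label x) by rewrite blockE; case: u xi => ->; rewrite ?orbT.
  rewrite (signing_block inj e ix) mulrCA; congr (_ * _)%R.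
  have [_ _ outer inner] := qP i.
  have ltab := ab i; have ltbc := bc i; have ltcd := cd i.
  have [eu|nu] := eqVneq u (s i).
    move: xi; rewrite eu outer => xi; rewrite (_ : block_sign _ _ _ _ _ _ = 1); last by rewrite /block_sign; lia.
    by case: (s i).
  have eu : u = ~~ s i by move: nu; case: u {xi}; case: (s i).
  move: xi; rewrite eu inner => xi; rewrite (_ : block_sign _ _ _ _ _ _ = (-1)%R); last by rewrite /block_sign; lia.
  by case: (s i).
rewrite -card_up; move: he; set D := bigop _ _ _ => he le_max.
have : p * (3 * t) <= p * (4 * D + 2 * p.-1) by rewrite leq_mul2l he orbT.
lia.
Qed.

Local Open Scope ring_scope.

Theorem theorem4 (t p : nat) (ht : (0 < t)%N) (hp : (0 < p)%N) :
  p%:R * (3 * t%:R - 2 * (p%:R - 1)) / 2 <= (Dstar t p)%:R :> rat.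
Proof.
rewrite /Dstar; case: ex_minnP => m /exists_inP [S SB /eqP <-] _.
have := max_discrepancy_ge SB ht hp.
rewrite -(ler_nat rat) natrD !natrM -subn1 natrB // => h.
rewrite ler_pdivrMr // mulrBr lerBlDr.
apply: le_trans (_ : p%:R * (3 * t%:R) <= _) _ => //; lra.
Qed.
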